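(* Let $n,m\in\mathbb{N}$ and let $P(z)=\sum_{j=-n}^{m}a_jz^j$ for $z\in\mathbb{C}\setminus\{0\}$, where $a_j\in\mathbb{C}$ for all integers $j$ with $-n\le j\le m$. Let $r>0$ and $M(r)=\max\{|P(z)|:|z|=r\}$. Then $$|a_j|\le\frac{M(r)}{r^j}\quad\text{for all } j\in\{-n,-n+1,\dots,m\}.$$
   Context: $\mathbb{N}=\{0,1,2,\dots\}$. *)

(* Defs.v *)
From mathcomp Require Import all_boot all_order all_algebra.
From mathcomp Require Import all_classical all_reals all_analysis.
From mathcomp Require Export complex.

Set Implicit Arguments.
Unset Strict Implicit.
Unset Printing Implicit Defensive.

Import Order.TTheory GRing.Theory Num.Theory.
Import numFieldNormedType.Exports.
Import ComplexField.Normc.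

Local Open Scope classical_set_scope.
Local Open Scope ring_scope.

(* The index k < n + m + 1 stands for the integer exponent j = k - n, so that j
   runs through -n, ..., m; only these values of [a] matter. *)
Definition laurent_poly (R : realType) (n m : nat) (a : int -> R[i])
    (z : R[i]) : R[i] :=
  \sum_(k < (n + m).+1) a (k%:Z - n%:Z) * z ^ (k%:Z - n%:Z).

(* [sup] is total; for Laurent polynomials and 0 < r it is a maximum, see
   [max_modulus_laurent_polyP] below. *)
Definition max_modulus (R : realType) (f : R[i] -> R[i]) (r : R) : R :=
  sup [set normc (f z) | z in [set z : R[i] | normc z = r]].

Section Attained.
Variable R : realType.

Let cont (f : R * R -> R[i]) (p : R * R) :=
  {for p, continuous (fun q => complex.Re (f q))} /\
  {for p, continuous (fun q => complex.Im (f q))}.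

Let contD f g p : cont f p -> cont g p -> cont (fun q => f q + g q) p.
Proof.
move=> [f1 f2] [g1 g2]; split.
  rewrite (_ : (fun _ => _) = (fun q => complex.Re (f q) + complex.Re (g q))).
    exact: continuousD.
  by apply/funext => q; case: (f q) (g q) => ? ? [].
rewrite (_ : (fun _ => _) = (fun q => complex.Im (f q) + complex.Im (g q))).
  exact: continuousD.
by apply/funext => q; case: (f q) (g q) => ? ? [].
Qed.

Let contM f g p : cont f p -> cont g p -> cont (fun q => f q * g q) p.
Proof.
move=> [f1 f2] [g1 g2]; split.
  rewrite (_ : (fun _ => _) = (fun q => complex.Re (f q) * complex.Re (g q) -
      complex.Im (f q) * complex.Im (g q))).
    by apply: continuousB; apply: continuousM.
  by apply/funext => q; case: (f q) (g q) => ? ? [].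
rewrite (_ : (fun _ => _) = (fun q => complex.Re (f q) * complex.Im (g q) +
    complex.Im (f q) * complex.Re (g q))).
  by apply: continuousD; apply: continuousM.
by apply/funext => q; case: (f q) (g q) => ? ? [].
Qed.

Let contC c p : cont (fun=> c) p.
Proof. by split; exact: cst_continuous. Qed.

Let contX f p k : cont f p -> cont (fun q => f q ^+ k) p.
Proof.
move=> fp; elim: k => [|k IH].
  rewrite (_ : (fun _ => _) = fun=> 1); first exact: contC.
  by apply/funext => q; rewrite expr0.
rewrite (_ : (fun _ => _) = fun q => f q * f q ^+ k); first exact: contM.
by apply/funext => q; rewrite exprS.
Qed.

Let cont_sum (I : Type) (s : seq I) (F : I -> R * R -> R[i]) p :
  (forall i, cont (F i) p) -> cont (fun q => \sum_(i <- s) F i q) p.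
Proof.
move=> Fp; elim: s => [|i s IH].
  rewrite (_ : (fun _ => _) = fun=> 0); first exact: contC.
  by apply/funext => q; rewrite big_nil.
rewrite (_ : (fun _ => _) = fun q => F i q + \sum_(j <- s) F j q).
  exact: contD.
by apply/funext => q; rewrite big_cons.
Qed.

Let toC (q : R * R) : R[i] := Complex q.1 q.2.

Let cont_toC p : cont toC p.
Proof. by split; [exact: cvg_fst | exact: cvg_snd]. Qed.

Let normcX (z : R[i]) k : normc (z ^+ k) = normc z ^+ k.
Proof. by elim: k => [|k IH]; rewrite ?normc1 // !exprS normcM IH. Qed.

Let normc_cont f p : cont f p -> {for p, continuous (fun q => normc (f q))}.
Proof.
move=> [f1 f2].
rewrite (_ : (fun _ => _) = (fun q => Num.sqrt
    (complex.Re (f q) ^+ 2 + complex.Im (f q) ^+ 2))); last first.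
  by apply/funext => q; case: (f q).
apply: (@continuous_comp _ _ _ (fun q =>
   complex.Re (f q) ^+ 2 + complex.Im (f q) ^+ 2) Num.sqrt).
  by apply: continuousD; apply: continuousM.
exact: sqrt_continuous.
Qed.

Let circle_compact (r : R) : compact [set q | normc (toC q) = r].
Proof.
apply: (@subclosed_compact _ _ (`[- r, r] `*` `[- r, r])).
- rewrite (_ : [set _ | _] = (fun q => normc (toC q)) @^-1` [set x | x = r]) //.
  apply: preimage_closed; last exact: closed_eq.
  by move=> q _; exact: normc_cont.
- by apply: compact_setX; exact: segment_compact.
- move=> [x y] /= <-; rewrite !in_itv /= -!ler_norml -!sqrtr_sqr.
  by rewrite !ler_wsqrtr // ?lerDl ?lerDr sqr_ge0.
Qed.

Lemma max_modulus_laurent_polyP (n m : nat) (a : int -> R[i]) (r : R) :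
  0 < r ->
  [set normc (laurent_poly n m a z) | z in [set z : R[i] | normc z = r]]
    (max_modulus (laurent_poly n m a) r) /\
  (forall z, normc z = r ->
     normc (laurent_poly n m a z) <= max_modulus (laurent_poly n m a) r).
Proof.
move=> r0; set P := laurent_poly n m a.
pose Q z := \sum_(k < (n + m).+1) a (k%:Z - n%:Z) * z ^+ k.
have PQ z : normc z = r -> normc (P z) = normc (Q z) / r ^+ n.
  move=> zr; have z0 : z != 0.
    by apply: contraTneq r0 => z0; rewrite -zr z0 normc0 ltxx.
  rewrite -zr -normcX -normcV -normcM /P /laurent_poly mulr_suml.
  by congr normc; apply: eq_bigr => k _; rewrite -mulrA expfzDr // exprnN.
have [|//|q] := @compact_EVT_max _ R (fun q => normc (Q (toC q)))
    _ _ (@circle_compact r).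
- exists (r, 0) => /=.
  by rewrite expr0n addr0 sqrtr_sqr ger0_norm // ltW.
- apply: continuous_in_subspaceT => p _; apply: normc_cont.
  by apply: cont_sum => k; apply: contM; [exact: contC | exact: contX].
rewrite inE /= => qr qmax.
have ub z : normc z = r -> normc (P z) <= normc (P (toC q)).
  case: z => x y zr; rewrite !PQ // ler_pM2r ?invr_gt0 ?exprn_gt0 //.
  by apply: (qmax (x, y)); rewrite inE.
suff -> : max_modulus P r = normc (P (toC q)) by split=> //; exists (toC q).
apply/eqP; rewrite eq_le; apply/andP; split.
  apply: ge_sup; first by exists (normc (P (toC q))), (toC q).
  by move=> _ [z zr <-]; exact: ub.
apply: ub_le_sup; last by exists (toC q).
by exists (normc (P (toC q))) => _ [z zr <-]; exact: ub.
Qed.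

End Attained.

(* Main.v *)
Require Import Defs.
From mathcomp Require Import all_boot all_order all_algebra.
From mathcomp Require Import all_classical all_reals all_analysis.
From mathcomp Require Import cyclic separable cyclotomic.

Import Order.TTheory GRing.Theory Num.Theory.
Import ComplexField.Normc.
Local Open Scope ring_scope.

(** This is Cauchy's estimate, with the average over the circle |z| = r
    replaced by the average over the N vertices r w^t of a regular N-gon, where
    N = n + m + 1 and w is a primitive N-th root of unity.  The exponents
    -n, ..., m are pairwise incongruent modulo N, so the orthogonality of the
    N-th roots of unity ([sum_prim_root_quot]) isolates one coefficient
    exactly ([laurent_coef_prim_root]):
      N a_j r^j = sum over t < N of P(r w^t) (w^t)^(-j).
    Each of the N terms on the right has modulus at most M(r), since
    |r w^t| = r and |w^t| = 1; dividing by N r^j gives the bound.  That M(r)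
    bounds |P| on the circle is [max_modulus_laurent_polyP]. *)

(** The invertibility of n makes 'X^n - 1 separable, so that over an
    algebraically closed field it has n distinct roots. *)
Lemma closed_prim_root_exists (F : closedFieldType) (n : nat) :
  n%:R != 0 :> F -> exists z : F, n.-primitive_root z.
Proof.
move=> n_neq0; have n_gt0 : (0 < n)%N by case: n n_neq0 => //; rewrite eqxx.
have [rs Dp] := closed_field_poly_normal ('X^n - 1 : {poly F}).
rewrite (monicP _) ?monicXnsubC // scale1r in Dp.
have rs1 : all n.-unity_root rs.
  by apply/allP => z; rewrite -root_prod_XsubC -Dp.
have sz_rs : (n < (size rs).+1)%N.
  by rewrite -(size_prod_XsubC rs id) -Dp size_XnsubC.
have [|z _ zP] := hasP (has_prim_root n_gt0 rs1 _ sz_rs); last by exists z.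
by rewrite -separable_prod_XsubC -Dp separable_Xn_sub_1.
Qed.

(** For i and k distinct, the quotient x of the two powers of w is an N-th root
    of unity other than 1, hence a root of 1 + x + ... + x^(N - 1). *)
Lemma sum_prim_root_quot (F : fieldType) (N : nat) (w : F) (i k : 'I_N) :
  N.-primitive_root w ->
  \sum_(t < N) (w ^+ i / w ^+ k) ^+ t = if i == k then N%:R else 0.
Proof.
move=> wP.
have w0 : w != 0 by rewrite (prim_root_eq0 wP) -lt0n (prim_order_gt0 wP).
have [->|neq_ik] := eqVneq i k.
  under eq_bigr do rewrite divff ?expf_neq0 // expr1n.
  by rewrite sumr_const card_ord.
set x := _ / _; have x1 : x - 1 != 0.
  rewrite subr_eq0; apply: contra neq_ik => /eqP x1.
  have /eqP : w ^+ i = w ^+ k by rewrite -[RHS]mul1r -x1 divfK ?expf_neq0.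
  by rewrite (eq_prim_root_expr wP) !modn_small.
apply: (mulfI x1); rewrite mulr0 -subrX1 /x expr_div_n -!exprM.
by rewrite ![(_ * N)%N]mulnC !exprM (prim_expr_order wP) !expr1n divr1 subrr.
Qed.

(** The discrete form of the Cauchy formula for the coefficients. *)
Lemma laurent_coef_prim_root (R : realType) (n m : nat) (a : int -> R[i])
    (c w : R[i]) (k : 'I_(n + m).+1) :
  (n + m).+1.-primitive_root w -> c != 0 ->
  \sum_(t < (n + m).+1) laurent_poly n m a (c * w ^+ t) *
      (w ^+ t) ^ (- (k%:Z - n%:Z)) =
    (n + m).+1%:R * (a (k%:Z - n%:Z) * c ^ (k%:Z - n%:Z)).
Proof.
move=> wP c0.
have w0 : w != 0 by rewrite (prim_root_eq0 wP) -lt0n (prim_order_gt0 wP).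
pose A (i : nat) := a (i%:Z - n%:Z) * c ^ (i%:Z - n%:Z).
transitivity (\sum_(t < (n + m).+1) \sum_(i < (n + m).+1)
    A i * (w ^+ i / w ^+ k) ^+ t).
  apply: eq_bigr => t _; rewrite mulr_suml; apply: eq_bigr => i _.
  rewrite exprzMl ?unitfE ?expf_neq0 // !mulrA -mulrA; congr (_ * _).
  rewrite -expfzDr ?expf_neq0 // opprB addrA subrK.
  rewrite expfzDr ?expf_neq0 // -exprnN -exprnP expr_div_n.
  by rewrite -!exprM ![(t * _)%N]mulnC.
rewrite exchange_big /= (bigD1 k) //= -mulr_sumr sum_prim_root_quot // eqxx.
rewrite big1 ?addr0 1?mulrC // => i neq_ik.
by rewrite -mulr_sumr sum_prim_root_quot // (negPf neq_ik) mulr0.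
Qed.

Lemma normcX (R : rcfType) (z : R[i]) (k : nat) : normc (z ^+ k) = normc z ^+ k.
Proof. by elim: k => [|k IH]; rewrite ?normc1 // !exprS normcM IH. Qed.

Lemma normcXz (R : rcfType) (z : R[i]) (j : int) : normc (z ^ j) = normc z ^ j.
Proof. by case: j => k; rewrite ?NegzE -?exprnN ?normcV -?exprnP normcX. Qed.

Lemma normc_real (R : rcfType) (x : R) : 0 <= x -> normc (Complex x 0) = x.
Proof. by move=> x0; rewrite /normc expr0n addr0 sqrtr_sqr ger0_norm. Qed.

Lemma normc_ge0 (R : rcfType) (z : R[i]) : 0 <= normc z.
Proof. by case: z => x y; exact: sqrtr_ge0. Qed.

Lemma normc_prim_root (R : rcfType) (N : nat) (w : R[i]) :
  N.-primitive_root w -> normc w = 1.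
Proof.
move=> wP; apply/eqP.
rewrite -(@pexpr_eq1 _ _ N) ?(prim_order_gt0 wP) ?normc_ge0 //.
by rewrite -normcX (prim_expr_order wP) normc1.
Qed.

Lemma normc_sum_le (R : rcfType) (N : nat) (F : 'I_N -> R[i]) (M : R) :
  (forall t, normc (F t) <= M) -> normc (\sum_t F t) <= M *+ N.
Proof.
move=> FM; rewrite -[X in M *+ X]card_ord -sumr_const.
elim/big_ind2: _ => [|X x Y y Xx Yy|t _]; rewrite ?normc0 //.
exact: le_trans (le_normcD x y) (lerD Xx Yy).
Qed.

Theorem proposition6p5 (R : realType) (n m : nat) (a : int -> R[i]) (r : R)
    (hr : 0 < r) :
  forall j : int, - n%:Z <= j -> j <= m%:Z ->
    normc (a j) <= max_modulus (laurent_poly n m a) r / r ^ j.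
Proof.
move=> j jn jm; set M := max_modulus _ _; pose N := (n + m).+1.
have [k kj] : exists k : 'I_N, k%:Z - n%:Z = j.
  have nj_ge0 : 0 <= j + n%:Z by rewrite -lerBlDr sub0r.
  have nj : (absz (j + n%:Z)%R < N)%N.
    by rewrite ltnS -lez_nat gez0_abs // PoszD addrC lerD2l.
  by exists (Ordinal nj); rewrite /= gez0_abs // addrK.
have [w wP] : exists w : R[i], N.-primitive_root w.
  by apply: closed_prim_root_exists; rewrite pnatr_eq0.
pose c : R[i] := Complex r 0.
have nc : normc c = r by rewrite normc_real // ltW.
have c0 : c != 0.
  by apply: contraTneq hr => c0; rewrite -nc c0 normc0 ltxx.
have nw t : normc (w ^+ t) = 1.
  by rewrite normcX (normc_prim_root _ _ _ wP) expr1n.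
have /(congr1 (@normc R)) := laurent_coef_prim_root _ _ _ a _ _ k wP c0.
rewrite kj mulr_natl normcMn normcM normcXz nc => avg.
have {avg} : (normc (a j) * r ^ j) *+ N <= M *+ N.
  rewrite -avg; apply: normc_sum_le => t.
  rewrite normcM normcXz nw exp1rz mulr1.
  have [_] := @max_modulus_laurent_polyP R n m a r hr; apply.
  by rewrite normcM nc nw mulr1.
by rewrite lerMn2r /= ler_pdivlMr ?exprz_gt0.
Qed.
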